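(* Let $n\in\mathbb N$, let $F$ be a field and $\xi\in F$. Let $\alpha\in\mathcal P_n$, and suppose the kernel-classes of $\alpha$ are $X_1,\dots,X_k$. Then the following are equivalent: (1) $\alpha\in E^\xi(\mathcal P_n)$, i.e. $\alpha\circ\alpha=\alpha$ in $\mathcal P_n^\xi$; (2) $\alpha\in E(\mathcal P_n)$ and $\operatorname{rank}(\alpha)\equiv k\pmod M$; (3) the following three conditions are satisfied: (i) $\alpha\in\mathcal P_{X_1}\oplus\cdots\oplus\mathcal P_{X_k}$; (ii) the restrictions $\alpha|_{X_i}$ all have rank at most $1$; (iii) the number of restrictions $\alpha|_{X_i}$ of rank $0$ is a multiple of $M$.
   Context: For a finite set $X$ with disjoint copy $X'$, $\mathcal P_X$ is the monoid of all set partitions $\alpha$ (into non-empty blocks) of $X\cup X'$; $\mathcal P_n=\mathcal P_{\mathbf n}$ with $\mathbf n=\{1,\dots,n\}$. Product: for $\alpha,\beta\in\mathcal P_X$ take a third copy $X''$; relabel each lower vertex $x'$ of $\alpha$ as $x''$ and each upper vertex $x$ of $\beta$ as $x''$, and take the union graph $\Gamma(\alpha,\beta)$ on $X\cup X'\cup X''$ (a partition being represented by a graph whose connected components are its blocks); $x,y\in X\cup X'$ are in the same block of $\alpha\beta$ iff they are joined by a path in $\Gamma(\alpha,\beta)$. $E(\mathcal P_n)=\{\alpha\in\mathcal P_n:\alpha^2=\alpha\}$. The rank of $\alpha$ is the number of blocks meeting both $X$ and $X'$. $\ker^\wedge(\alpha)$ (resp. $\ker_\vee(\alpha)$) is the equivalence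 on $X$ relating $x,y$ iff $x,y$ (resp. $x',y'$) are in the same block of $\alpha$; $\ker(\alpha)=\ker^\wedge(\alpha)\vee\ker_\vee(\alpha)$ is the smallest equivalence containing both, and its classes are the kernel-classes of $\alpha$. If $X=X_1\sqcup\dots\sqcup X_k$, then $\mathcal P_{X_1}\oplus\cdots\oplus\mathcal P_{X_k}$ is the set of $\alpha\in\mathcal P_X$ each of whose blocks is contained in some $X_i\cup X_i'$; for such $\alpha$, $\alpha|_{X_i}=\{A\in\alpha:A\subseteq X_i\cup X_i'\}\in\mathcal P_{X_i}$. The partition algebra $\mathcal P_n^\xi$ is the $F$-algebra with basis $\mathcal P_n$ and product given on basis elements by $\alpha\circ\beta=\xi^{m(\alpha,\beta)}(\alpha\beta)$, where $m(\alpha,\beta)$ is the number of connected components of $\Gamma(\alpha,\beta)$ entirely contained in $\mathbf n''$ (with $\xi^0=1$). $E^\xi(\mathcal P_n)=\{\alpha\in\mathcal P_n:\alpha\circ\alpha=\alpha\}$. $M=m$ if $\xi$ is a root of unity of order $m$ (i.e. $m\geq 1$ is least with $\xi^m=1$) with $m\le n$, and $M=0$ otherwise. Congruence modulo $0$ means equality, and the only multiple of $0$ is $0$. *)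

(* Defs.v *)
From HB Require Import structures.
From mathcomp Require Import all_boot all_order all_algebra.

Set Implicit Arguments.
Unset Strict Implicit.
Unset Printing Implicit Defensive.

Import GRing.Theory.
Local Open Scope ring_scope.

(* The disjoint union of X and its copy X' is the sum type X + X:
   [inl x] is the upper vertex x and [inr x] is the lower vertex x'. *)
Record ppart (X : finType) := PPart {
  blocks :> {set {set X + X}};
  blocksP : partition blocks [set: X + X]
}.

HB.instance Definition _ (X : finType) := [isSub for @blocks X].
HB.instance Definition _ (X : finType) := [Finite of ppart X by <:].

Section PartitionMonoid.
Variable X : finType.
Implicit Types (a b : ppart X) (s t : X + X) (u v : X + X + X).

(* The vertices of the product graph are X + X + X: [inl s] is the vertex s
   of X and X', and [inr x] is the vertex x'' of the third copy. *)
Definition upper_copy s : X + X + X :=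
  match s with inl x => inl (inl x) | inr x => inr x end.

Definition lower_copy s : X + X + X :=
  match s with inl x => inr x | inr x => inl (inr x) end.

(* Each partition is represented by the graph in which two vertices are
   adjacent when they lie in the same block. *)
Definition pgraph a b : rel (X + X + X) := fun u v =>
     [exists s, exists t,
        [&& u == upper_copy s, v == upper_copy t & t \in pblock a s]]
  || [exists s, exists t,
        [&& u == lower_copy s, v == lower_copy t & t \in pblock b s]].

Lemma pblock_ppart_sym a s t : (t \in pblock a s) = (s \in pblock a t).
Proof.
have /and3P[/eqP cova triva _] := blocksP a.
by rewrite -!eq_pblock ?cova ?inE // eq_sym.
Qed.

Lemma pgraph_connect_sym a b : connect_sym (pgraph a b).
Proof.
apply: sym_connect_sym => u v; rewrite /pgraph; congr (_ || _);
  apply/existsP/existsP => -[s /existsP[t /and3P[us vt st]]];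
  by exists t; apply/existsP; exists s; rewrite us vt pblock_ppart_sym.
Qed.

Lemma pmul_subproof a b :
  partition
    (equivalence_partition
       (fun s t => connect (pgraph a b) (inl s) (inl t)) [set: X + X])
    [set: X + X].
Proof.
apply: equivalence_partitionP => s t r _ _ _; split=> // st.
exact: (same_connect (@pgraph_connect_sym a b)).
Qed.

Definition pmul a b : ppart X := PPart (pmul_subproof a b).

Definition pfloating a b : nat :=
  #|[set C in equivalence_partition (connect (pgraph a b)) [set: X + X + X]
      | C \subset [set inr x | x : X]]|.

Definition pidem : {set ppart X} := [set a | pmul a a == a].

(* The rank is defined for an arbitrary family of blocks so that it also
   applies to the restrictions [prestr] below. *)
Definition prank (P : {set {set X + X}}) : nat :=
  #|[set B in P | [exists x, inl x \in B] && [exists y, inr y \in B]]|.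

Definition ker_upper a : rel X := fun x y => inl y \in pblock a (inl x).
Definition ker_lower a : rel X := fun x y => inr y \in pblock a (inr x).

Definition eqv_join (r1 r2 : rel X) : rel X :=
  connect (fun x y => r1 x y || r2 x y).

Definition pker a : rel X := eqv_join (ker_upper a) (ker_lower a).

Lemma pker_equivalence a : equivalence_rel (pker a).
Proof.
apply/equivalence_relP; split=> [x|x y xy z]; first exact: connect0.
apply: (same_connect _ xy); apply: sym_connect_sym => {}x {xy z}y.
by rewrite /ker_upper /ker_lower pblock_ppart_sym [inr y \in _]pblock_ppart_sym.
Qed.

Lemma pker_least a (e : rel X) :
    equivalence_rel e -> subrel (ker_upper a) e -> subrel (ker_lower a) e ->
  [/\ subrel (ker_upper a) (pker a), subrel (ker_lower a) (pker a)
    & subrel (pker a) e].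
Proof.
move=> /equivalence_relP[e0 eT] ue le.
split=> x y; [by move=> h; apply: connect1; rewrite h
  | by move=> h; apply: connect1; rewrite h orbT |].
case/connectP=> p; elim: p x => [|z p IHp] x /=; first by move=> _ ->.
by case/andP=> /orP[/ue | /le] xz pz lp; rewrite (eT _ _ xz); apply: IHp.
Qed.

Definition kernel_classes a : {set {set X}} :=
  equivalence_partition (pker a) [set: X].

Definition both_copies (A : {set X}) : {set X + X} :=
  [set inl x | x in A] :|: [set inr x | x in A].

Definition pdsum (I : finType) (A : I -> {set X}) : {set ppart X} :=
  [set a : ppart X |
     [forall B in blocks a, exists i, B \subset both_copies (A i)]].

(* An element of P_A for A a subset of X is encoded by its family of blocks,
   a partition of [both_copies A]; see [prestr_partition]. *)
Definition prestr a (A : {set X}) : {set {set X + X}} :=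
  [set B in blocks a | B \subset both_copies A].

Lemma prestr_partition (I : finType) (A : I -> {set X}) a i :
    (forall j j', j != j' -> [disjoint A j & A j']) -> a \in pdsum A ->
  partition (prestr a (A i)) (both_copies (A i)).
Proof.
move=> disA; rewrite inE => /forall_inP aA.
have /and3P[/eqP cova triva na0] := blocksP a.
have copyE j s : (s \in both_copies (A j)) =
    (match s with inl x => x | inr x => x end \in A j).
  rewrite inE; case: s => x; rewrite mem_imset; try by move=> ? ? [].
    by case: imsetP => [[]|] //; rewrite orbF.
  by case: imsetP => [[]|].
apply/and3P; split.
- rewrite eqEsubset; apply/andP; split.
    by apply/bigcupsP=> B; rewrite inE => /andP[].
  apply/subsetP=> s sA; have : s \in cover a by rewrite cova.
  case/bigcupP=> B aB sB; apply/bigcupP; exists B => //; rewrite inE aB /=.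
  have /existsP[j sBj] := aA B aB.
  have [<-//|ji] := eqVneq j i.
  have := disjointFr (disA _ _ ji); move: (subsetP sBj _ sB) sA.
  by rewrite !copyE => h1 h2 /(_ _ h1); rewrite h2.
- apply/trivIsetP=> B C; rewrite !inE => /andP[aB _] /andP[aC _].
  exact: (trivIsetP triva).
- by rewrite inE (negPf na0).
Qed.

End PartitionMonoid.

Section PartitionAlgebra.
Variables (F : fieldType) (X : finType) (xi : F).

(* The underlying vector space is {ffun ppart X -> F^o}; its product is [palg_mul]
   and not the pointwise one. *)
Definition pbasis (a : ppart X) : {ffun ppart X -> F^o} :=
  [ffun b => (b == a)%:R].

Definition palg_mul (f g : {ffun ppart X -> F^o}) : {ffun ppart X -> F^o} :=
  \sum_(a : ppart X) \sum_(b : ppart X)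
     (f a * g b * xi ^+ pfloating a b) *: pbasis (pmul a b).

Lemma palg_mul_basis a b :
  palg_mul (pbasis a) (pbasis b) = xi ^+ pfloating a b *: pbasis (pmul a b).
Proof.
rewrite /palg_mul (bigD1 a) //= [X in _ + X]big1 => [|c ca]; last first.
  by apply: big1 => d _; rewrite ffunE (negPf ca) !mul0r scale0r.
rewrite addr0 (bigD1 b) //= [X in _ + X]big1 => [|d db]; last first.
  by rewrite [pbasis b d]ffunE (negPf db) mulr0 mul0r scale0r.
by rewrite !ffunE !eqxx !mul1r addr0.
Qed.

Definition pidem_xi : {set ppart X} :=
  [set a | palg_mul (pbasis a) (pbasis a) == pbasis a].

End PartitionAlgebra.

(* Since a primitive root has a unique order, the choice made by [pick] is
   the only possible one. *)
Definition unity_order (F : fieldType) (n : nat) (xi : F) : nat :=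
  if [pick m : 'I_n.+1 | m.-primitive_root xi] is Some m then val m else 0%N.

(* Main.v *)
Require Import Defs.
From mathcomp Require Import all_boot all_order all_algebra.
Set Implicit Arguments.
Unset Strict Implicit.
Unset Printing Implicit Defensive.
Local Open Scope ring_scope.

(** Write s ~ t when s and t lie in the same block of a.

    Since a block of a is a clique of the product graph of a with itself, a
    path between middle vertices can be shortcut so that it never leaves the
    middle row.  Hence each kernel-class K spans exactly one connected component
    through the middle row; that component also contains the upper vertices of
    the transversal blocks whose lower part meets K and the lower vertices of
    those whose upper part meets K ([connect_middle]).  All three conditions are
    read off from this picture.

    Idempotency.  If a is idempotent and x ~ y', the path y'' - x - y' - x''
    forces x and y into one kernel-class, and two transversal blocks attached to
    one class are joined through it, hence equal.  Conversely, if every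
    transversal block joins a class to itself and each class carries at most one
    of them, then passing through a class always leads back to the block one
    came from.  So idempotency is the conjunction of the two local conditions
    [ker_local] and [single_transversal], which restate (i) and (ii); this is
    [idempotentP].

    Counting.  Under (i) a component floats in the middle row exactly when its
    class carries no transversal block, so the exponent of xi in the square of a
    is the number r of restrictions of rank 0 ([pfloating_rank0]).  Under (i)
    and (ii) each of the k classes carries one or no transversal block, whence
    rank a + r = k ([prank_add_rank0]).  Finally xi ^+ r = 1 means that r is a
    multiple of M because r <= n ([unity_order_dvd]), so that the conditions on
    xi, on the rank and on r all agree. *)

(** * Blocks, product graph and kernel *)

Section Partition.
Variable X : finType.
Implicit Types (a b : ppart X) (s t : X + X) (u v : X + X + X) (x y z w : X).
Implicit Types (B : {set X + X}) (K : {set X}).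

Lemma trivIset_ppart a : trivIset a.
Proof. by case/and3P: (blocksP a). Qed.

Lemma cover_ppart a s : s \in cover a.
Proof. by case/and3P: (blocksP a) => /eqP-> _ _; rewrite inE. Qed.

Lemma pblock_refl a s : s \in pblock a s.
Proof. by rewrite mem_pblock cover_ppart. Qed.

Lemma pblock_eq a s t : t \in pblock a s -> pblock a t = pblock a s.
Proof. exact: (same_pblock (trivIset_ppart a)). Qed.

Lemma ppartP a b :
  (forall s t, (t \in pblock a s) = (t \in pblock b s)) <-> a = b.
Proof.
split=> [ab|-> //]; apply: val_inj => /=.
rewrite -(equivalence_partition_pblock (blocksP a)).
rewrite -(equivalence_partition_pblock (blocksP b)).
by apply: eq_imset => s; apply/setP=> t; rewrite !inE ab.
Qed.

Lemma mem_pblock_pmul a b s t :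
  (t \in pblock (pmul a b) s) = connect (pgraph a b) (inl s) (inl t).
Proof.
rewrite /= pblock_equivalence_partition ?inE // => {}s {}t r _ _ _.
by split=> // st; apply: (same_connect (@pgraph_connect_sym X a b)).
Qed.

Lemma connect_upper a b s t :
  t \in pblock a s -> connect (pgraph a b) (upper_copy s) (upper_copy t).
Proof.
move=> st; apply/connect1/orP; left; apply/existsP; exists s.
by apply/existsP; exists t; rewrite !eqxx.
Qed.

Lemma connect_lower a b s t :
  t \in pblock b s -> connect (pgraph a b) (lower_copy s) (lower_copy t).
Proof.
move=> st; apply/connect1/orP; right; apply/existsP; exists s.
by apply/existsP; exists t; rewrite !eqxx.
Qed.

(** Tracking the two factors separately lets invariance along edges be checked
    on the blocks of a and of b, whatever vertices the copies turn them into. *)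
Lemma pgraph_connect_ind a b (Q : pred (X + X + X)) :
    (forall s t, t \in pblock a s -> Q (upper_copy s) -> Q (upper_copy t)) ->
    (forall s t, t \in pblock b s -> Q (lower_copy s) -> Q (lower_copy t)) ->
  forall u v, connect (pgraph a b) u v -> Q u -> Q v.
Proof.
move=> Qa Qb u v /connectP[p]; elim: p u => [|r p IHp] u /=; first by move=> _ ->.
case/andP=> ur pth lst Qu; apply: (IHp r) => //.
by case/orP: ur Qu => /existsP[s /existsP[t /and3P[/eqP-> /eqP-> st]]];
  [apply: Qa | apply: Qb].
Qed.

Lemma pker_refl a x : pker a x x.
Proof. exact: connect0. Qed.

Lemma pker_trans a y x z : pker a x y -> pker a y z -> pker a x z.
Proof. exact: connect_trans. Qed.

Lemma pker_sym a x y : pker a x y = pker a y x.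
Proof.
have /equivalence_relP[ker0 kerT] := pker_equivalence a.
by apply/idP/idP=> h; rewrite -(kerT _ _ h) ker0.
Qed.

Lemma pker_upper a x y : inl y \in pblock a (inl x) -> pker a x y.
Proof. by move=> xy; apply: connect1; rewrite /ker_upper xy. Qed.

Lemma pker_lower a x y : inr y \in pblock a (inr x) -> pker a x y.
Proof. by move=> xy; apply: connect1; rewrite /ker_lower xy orbT. Qed.

Lemma pker_connect a x y : pker a x y -> connect (pgraph a a) (inr x) (inr y).
Proof.
case/connectP=> p; elim: p x => [|z p IHp] x /=; first by move=> _ ->.
case/andP=> xz pth lst; apply: connect_trans (IHp z pth lst).
by case/orP: xz => [/(connect_lower a) | /(connect_upper a)].
Qed.

(** The component of the middle vertex x'' in the product graph of a with
    itself, as described in terms of a alone. *)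
Definition middle_component a x : pred (X + X + X) := fun v =>
  match v with
  | inr y => pker a x y
  | inl (inl z) => [exists w, pker a x w && (inr w \in pblock a (inl z))]
  | inl (inr z) => [exists w, pker a x w && (inl w \in pblock a (inr z))]
  end.

(** Seen from the first factor, the component consists of the blocks that have
    a lower vertex over the kernel-class of x; this form also covers the middle
    vertices, so that invariance along the edges of that factor is immediate. *)
Lemma middle_component_upper a x s :
  middle_component a x (upper_copy s) =
    [exists w, pker a x w && (inr w \in pblock a s)].
Proof.
case: s => y //=; apply/idP/existsP=> [xy|[w /andP[xw]]].
  by exists y; rewrite xy pblock_refl.
by move/pker_lower; rewrite pker_sym; apply: pker_trans.
Qed.

Lemma middle_component_lower a x s :
  middle_component a x (lower_copy s) =
    [exists w, pker a x w && (inl w \in pblock a s)].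
Proof.
case: s => y //=; apply/idP/existsP=> [xy|[w /andP[xw]]].
  by exists y; rewrite xy pblock_refl.
by move/pker_upper; rewrite pker_sym; apply: pker_trans.
Qed.

Lemma connect_middle a x v :
  connect (pgraph a a) (inr x) v -> middle_component a x v.
Proof.
move=> xv.
by apply: pgraph_connect_ind xv (pker_refl a x) => s t st;
  rewrite (middle_component_upper, middle_component_lower)
          (middle_component_upper, middle_component_lower) (pblock_eq st).
Qed.

(** * Idempotency as a local condition on kernel-classes *)

Definition ker_local a : Prop :=
  forall x y, inr y \in pblock a (inl x) -> pker a x y.

Definition single_transversal a : Prop :=
  forall x y z w, inr y \in pblock a (inl x) -> inr w \in pblock a (inl z) ->
    pker a x z -> inl z \in pblock a (inl x).

(** The path y'' - x - y' - x'' joins x'' to y'' as soon as y' lies in the block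
    of x both in a and in its square. *)
Lemma idempotent_ker_local a : pmul a a = a -> ker_local a.
Proof.
move=> aa x y xy; have := xy; rewrite -{1}aa mem_pblock_pmul => cxy.
apply: (@connect_middle a x (inr y)).
apply: connect_trans (connect_upper a xy).
rewrite (pgraph_connect_sym a a); apply: (connect_trans cxy).
by rewrite (pgraph_connect_sym a a); apply: (connect_lower a xy).
Qed.

(** The path x - y'' - x'' - z'' - w' puts w' into the block of x. *)
Lemma idempotent_single_transversal a :
  pmul a a = a -> single_transversal a.
Proof.
move=> aa x y z w xy zw xz.
have yz : pker a y z.
  by apply: pker_trans xz; rewrite pker_sym; apply: idempotent_ker_local xy.
have : inr w \in pblock a (inl x).
  rewrite -aa mem_pblock_pmul.
  apply: connect_trans (connect_lower a zw).
  exact: connect_trans (connect_upper a xy) (pker_connect yz).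
by move/pblock_eq <-; rewrite (pblock_eq zw) pblock_refl.
Qed.

(** Fix the block B of s.  The vertices reachable from s are those of B together
    with, when B is transversal, the middle vertices over its kernel-class: the
    two local conditions say that this set cannot be left along an edge. *)
Lemma connect_outer a s t : ker_local a -> single_transversal a ->
  connect (pgraph a a) (inl s) (inl t) -> t \in pblock a s.
Proof.
move=> loc single.
pose B := pblock a s.
have BP r r' : r' \in pblock a r -> r \in B -> r' \in B.
  by move=> rr' /pblock_eq rB; rewrite /B -rB.
have BE r r' : r \in B -> r' \in B -> r' \in pblock a r.
  by move=> /pblock_eq->.
pose Q (v : X + X + X) := match v with
  | inl r => r \in B
  | inr y => [exists x, [&& pker a x y, inl x \in B & [exists w, inr w \in B]]]
  end.
have QP y : reflect (exists x w, [/\ pker a x y, inl x \in B & inr w \in B])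
    (Q (inr y)).
  apply: (iffP existsP) => [[x /and3P[xy xB /existsP[w wB]]]|[x [w [xy xB wB]]]].
    by exists x, w.
  by exists x; rewrite xy xB; apply/existsP; exists w.
have Qker y y' : pker a y y' -> Q (inr y) -> Q (inr y').
  move=> yy' /QP[x [w [xy xB wB]]]; apply/QP; exists x, w; split=> //.
  exact: pker_trans yy'.
move=> st; suff: Q (inl t) by [].
have Qs : Q (inl s) by apply: pblock_refl.
apply: pgraph_connect_ind st Qs => -[x|x] [y|y] xy; rewrite /upper_copy /lower_copy.
- exact: BP.
- move=> xB; apply/QP; exists x, y; split=> //; first exact: loc.
  exact: BP xB.
- case/QP=> z [w [zx zB wB]]; rewrite pblock_ppart_sym in xy.
  apply: (BP _ _ _ zB); apply: (single _ _ _ _ (BE _ _ zB wB) xy).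
  by apply: (pker_trans zx); rewrite pker_sym; apply: loc.
- exact/Qker/(pker_lower xy).
- exact/Qker/(pker_upper xy).
- case/QP=> z [w [zx zB wB]].
  apply: (BP _ _ xy (BP _ _ _ zB)).
  exact: (single _ _ _ _ (BE _ _ zB wB) xy zx).
- move=> xB; rewrite pblock_ppart_sym in xy; apply/QP; exists y, x.
  by split=> //; [exact: pker_refl | apply: BP xB; rewrite pblock_ppart_sym].
- exact: BP.
Qed.

(** Only transversal blocks need an argument, as their upper and lower vertices
    are joined by an edge of neither factor: the path is x - y'' - x'' - y', with
    middle part inside a kernel-class by [ker_local]. *)
Lemma connect_same_block a s t : ker_local a ->
  t \in pblock a s -> connect (pgraph a a) (inl s) (inl t).
Proof.
move=> loc.
have cross x y : inr y \in pblock a (inl x) ->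
    connect (pgraph a a) (inl (inl x)) (inl (inr y)).
  move=> xy; apply: connect_trans (connect_upper a xy) _.
  apply: connect_trans (connect_lower a xy).
  by apply: pker_connect; rewrite pker_sym; apply: loc.
case: s t => [x|x] [y|y] xy.
- exact: (connect_upper a xy).
- exact: cross.
- rewrite (pgraph_connect_sym a a); apply: cross.
  by rewrite pblock_ppart_sym.
- exact: (connect_lower a xy).
Qed.

Lemma idempotentP a : pmul a a = a <-> ker_local a /\ single_transversal a.
Proof.
split=> [aa|[loc single]].
  by split; [apply: idempotent_ker_local | apply: idempotent_single_transversal].
apply/ppartP => s t; rewrite mem_pblock_pmul.
by apply/idP/idP; [apply: connect_outer | apply: connect_same_block].
Qed.

(** * Restrictions to the kernel-classes *)

Definition vertex s : X := match s with inl x => x | inr x => x end.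

Lemma mem_both_copies K s : (s \in both_copies K) = (vertex s \in K).
Proof.
rewrite inE; case: s => x /=; rewrite mem_imset; try by move=> ? ? [].
  by case: imsetP => [[]|] //; rewrite orbF.
by case: imsetP => [[]|].
Qed.

Lemma pker_vertex a s t :
  ker_local a -> t \in pblock a s -> pker a (vertex s) (vertex t).
Proof.
move=> loc; case: s t => [x|x] [y|y] /=;
  [exact: pker_upper | exact: loc | | exact: pker_lower].
by rewrite pblock_ppart_sym pker_sym; apply: loc.
Qed.

Definition transversal_block B := [exists x, inl x \in B] && [exists y, inr y \in B].

Lemma transversal_blockP a B :
  reflect (exists x y, inr y \in pblock a (inl x) /\ B = pblock a (inl x))
          ((B \in blocks a) && transversal_block B).
Proof.
apply: (iffP and3P) => [[aB /existsP[x xB] /existsP[y yB]]|[x [y [xy ->]]]].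
  by exists x, y; rewrite (def_pblock (trivIset_ppart a) aB xB).
split; first by rewrite pblock_mem ?cover_ppart.
  by apply/existsP; exists x; apply: pblock_refl.
by apply/existsP; exists y.
Qed.

Section KernelClasses.
Variables (I : finType) (A : I -> {set X}) (a : ppart X).
Hypothesis A_inj : injective A.
Hypothesis A_classes : [set A i | i : I] = kernel_classes a.

Lemma mem_class i x y : x \in A i -> (y \in A i) = pker a x y.
Proof.
have: A i \in kernel_classes a by rewrite -A_classes imset_f.
case/imsetP=> z _ ->; rewrite !inE /= => zx.
apply/idP/idP; last exact: pker_trans.
by apply: pker_trans; rewrite pker_sym.
Qed.

Lemma class_exists x : exists i, x \in A i.
Proof.
have: [set y in [set: X] | pker a x y] \in [set A i | i : I].
  by rewrite A_classes imset_f.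
by case/imsetP=> i _ Ai; exists i; rewrite -Ai !inE pker_refl.
Qed.

Lemma class_nonempty i : exists x, x \in A i.
Proof.
have: A i \in kernel_classes a by rewrite -A_classes imset_f.
by case/imsetP=> z _ ->; exists z; rewrite !inE pker_refl.
Qed.

Lemma class_unique i j x : x \in A i -> x \in A j -> i = j.
Proof.
move=> xi xj; apply/A_inj/setP=> y.
by rewrite (mem_class y xi) (mem_class y xj).
Qed.

Lemma leq_card_classes : (#|I| <= #|X|)%N.
Proof.
rewrite -(card_imset predT A_inj) -cardsT.
by have -> : A @: predT = kernel_classes a; last exact: leq_imset_card.
Qed.

Lemma pdsum_ker_local : a \in pdsum A <-> ker_local a.
Proof.
split=> [|loc].
  rewrite inE => /forall_inP aA x y xy.
  have /aA/existsP[i /subsetP sB] : pblock a (inl x) \in blocks a.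
    by rewrite pblock_mem ?cover_ppart.
  have := sB _ (pblock_refl a (inl x)); have := sB _ xy.
  by rewrite !mem_both_copies /= => yi xi; rewrite -(mem_class y xi).
rewrite inE; apply/forall_inP=> B aB.
have /set0Pn[s sB] : B != set0.
  by apply: contraTneq aB => ->; case/and3P: (blocksP a).
have [i si] := class_exists (vertex s); apply/existsP; exists i.
apply/subsetP=> t tB; rewrite mem_both_copies (mem_class _ si).
by apply: pker_vertex => //; rewrite (def_pblock (trivIset_ppart a) aB sB).
Qed.

Hypothesis loc : ker_local a.

Lemma pblock_sub_class i s :
  (pblock a s \subset both_copies (A i)) = (vertex s \in A i).
Proof.
apply/subsetP/idP=> [/(_ s)|si t st].
  by rewrite pblock_refl mem_both_copies => ->.
by rewrite mem_both_copies (mem_class _ si) pker_vertex.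
Qed.

Lemma transversal_prestrP i B :
  reflect (exists x y, [/\ x \in A i, inr y \in pblock a (inl x)
                         & B = pblock a (inl x)])
          (B \in [set B in prestr a (A i) | transversal_block B]).
Proof.
rewrite !inE andbAC.
apply: (iffP andP) => [[/transversal_blockP[x [y [xy ->]]]]|[x [y [xi xy ->]]]].
  by rewrite pblock_sub_class => xi; exists x, y.
by rewrite pblock_sub_class; split=> //; apply/transversal_blockP; exists x, y.
Qed.

Lemma rank_le1_single_transversal :
  (forall i, (prank (prestr a (A i)) <= 1)%N) <-> single_transversal a.
Proof.
split=> [rk x y z w xy zw xz|single i].
  have [i xi] := class_exists x.
  have /card_le1_eqP le1 := rk i.
  suff <- : pblock a (inl z) = pblock a (inl x) by apply: pblock_refl.
  apply: le1; apply/transversal_prestrP; first by exists x, y.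
  by exists z, w; rewrite (mem_class _ xi).
apply/card_le1_eqP => B C /transversal_prestrP[x [y [xi xy ->]]].
case/transversal_prestrP=> z [w [zi zw ->]].
by apply: pblock_eq; apply: (single _ _ _ _ xy zw); rewrite -(mem_class _ xi).
Qed.

Lemma rank0P i :
  reflect (forall x y, x \in A i -> inr y \notin pblock a (inl x))
          (prank (prestr a (A i)) == 0%N).
Proof.
rewrite cards_eq0; apply: (iffP eqP) => [T0 x y xi|noT].
  apply/negP=> xy; have := in_set0 (pblock a (inl x)).
  by rewrite -T0 => /negP[]; apply/transversal_prestrP; exists x, y.
apply/setP=> B; rewrite in_set0; apply/negP=> /transversal_prestrP[x [y [xi]]].
by rewrite (negPf (noT _ _ xi)).
Qed.

(** * Counting kernel-classes and floating components *)

(** Under [ker_local] every block lies over exactly one kernel-class, so the sum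
    over the classes counts each transversal block once. *)
Lemma prank_sum : prank a = (\sum_i prank (prestr a (A i)))%N.
Proof.
have rankE i : prank (prestr a (A i)) =
    (\sum_(B | (B \in blocks a) && transversal_block B
               && (B \subset both_copies (A i))) 1)%N.
  rewrite sum1dep_card; apply: eq_card => B.
  by rewrite !inE andbAC.
rewrite (eq_bigr _ (fun i _ => rankE i)).
rewrite (exchange_big_dep (fun B => (B \in blocks a) && transversal_block B)) /=;
  last by move=> i B _ /andP[].
rewrite /prank -sum1dep_card; apply: eq_bigr => B aB.
have /transversal_blockP[x [y [xy BE]]] := aB.
have [i xi] := class_exists x.
rewrite (big_pred1 i) // => j; rewrite aB BE pblock_sub_class /=.
by apply/idP/eqP=> [xj|-> //]; apply: class_unique xj xi.
Qed.

Lemma prank_add_rank0 :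
    (forall i, (prank (prestr a (A i)) <= 1)%N) ->
  (prank a + #|[set i | prank (prestr a (A i)) == 0]| = #|I|)%N.
Proof.
move=> rk; rewrite prank_sum -sum1dep_card [X in (_ + X)%N]big_mkcond.
rewrite -big_split -sum1_card /=.
by apply: eq_bigr => i _; case: (prank _) (rk i) => [|[]].
Qed.

(** A floating component is the middle copy of a kernel-class, and this class
    cannot carry a transversal block, whose vertices would lie in the component;
    conversely the component over a class without transversal block stays in the
    middle row by the description of components. *)
Lemma pfloating_rank0 :
  pfloating a a = #|[set i | prank (prestr a (A i)) == 0%N]|.
Proof.
pose up i : {set X + X + X} := [set inr x | x in A i].
have mem_up i x : (inr x \in up i) = (x \in A i).
  by rewrite mem_imset // => ? ? [].
have up_inj : injective up.
  by move=> i j ij; apply/A_inj/setP=> x; rewrite -!mem_up ij.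
rewrite -(card_imset _ up_inj); apply: eq_card => C; rewrite inE.
apply/andP/imsetP=> [[/imsetP[u _ CE] /subsetP Csub]|[i]].
  have memC v : (v \in C) = connect (pgraph a a) u v by rewrite CE !inE.
  have /imsetP[x _ uE] : u \in [set inr x | x : X].
    by apply: Csub; rewrite memC connect0.
  rewrite {}uE in memC; have [i xi] := class_exists x.
  exists i.
    rewrite inE; apply/rank0P=> z y zi; apply/negP=> zy.
    have : inl (inl z) \in C.
      rewrite memC (@connect_trans _ _ (inr y)) //.
        by apply: pker_connect; apply: pker_trans (loc zy); rewrite -(mem_class _ xi).
      by rewrite (pgraph_connect_sym a a); apply: (connect_upper a zy).
    by move/Csub/imsetP=> [].
  apply/setP=> -[r|y].
    apply/idP/idP=> [/Csub|] /imsetP[] //.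
  rewrite mem_up memC (mem_class _ xi).
  by apply/idP/idP; [move/connect_middle | apply: pker_connect].
rewrite inE => /rank0P noT ->; have [x xi] := class_nonempty i.
split; last by apply/subsetP=> _ /imsetP[y _ ->]; apply: imset_f.
apply/imsetP; exists (inr x) => //; apply/setP=> -[r|y]; rewrite !inE /=.
  (* No outer vertex on either side, since noT excludes its transversal block. *)
  transitivity false; first by apply/imsetP=> -[].
  apply/esym/negP=> /connect_middle; case: r => z /existsP[w /andP[xw]].
    move=> zw; have := noT z w; rewrite zw => /(_ _)/negP; case=> //.
    by rewrite (mem_class _ xi); apply: pker_trans xw _; rewrite pker_sym; apply: loc.
  rewrite pblock_ppart_sym => wz; have := noT w z.
  by rewrite wz (mem_class _ xi) xw => /(_ isT).
rewrite mem_up (mem_class _ xi).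
by apply/idP/idP; [apply: pker_connect | move/connect_middle].
Qed.

End KernelClasses.

(** * The twisted product *)

(** The square of the basis vector of a is a scalar multiple of one basis vector,
    so it can only be the basis vector of a if both the partition and the scalar
    agree. *)
Lemma pidem_xiE (F : fieldType) (xi : F) a :
  (a \in pidem_xi X xi) = (a \in pidem X) && (xi ^+ pfloating a a == 1).
Proof.
rewrite !inE palg_mul_basis; apply/eqP/andP=> [e|[/eqP-> /eqP->]]; last first.
  by rewrite GRing.scale1r.
have := congr1 (fun f : {ffun ppart X -> F^o} => f a) e; rewrite !ffunE eqxx.
rewrite [a == _]eq_sym; case: eqP => /= _; last first.
  by rewrite GRing.scaler0 => /esym/eqP; rewrite GRing.oner_eq0.
by move/eqP; rewrite -[_ *: _]/(_ * _) GRing.mulr1.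
Qed.

End Partition.

(** The bound on m is what makes the convention M = 0 for roots of unity of order
    greater than n harmless: such an order divides no m with 0 < m <= n. *)
Lemma unity_order_dvd (F : fieldType) (xi : F) (n m : nat) : (m <= n)%N ->
  (unity_order n xi %| m)%N = (xi ^+ m == 1).
Proof.
move=> mn; rewrite /unity_order; case: pickP => [d dP|noP].
  by rewrite (prim_order_dvd dP).
case: m mn => [|m] mn; first by rewrite GRing.expr0 eqxx.
rewrite dvd0n; apply/esym/negP=> /eqP xim.
have [d dP dm] := prim_order_exists (ltn0Sn m) xim.
have dn : (d < n.+1)%N by rewrite ltnS (leq_trans (dvdn_leq _ dm)).
by have := noP (Ordinal dn); rewrite /= dP.
Qed.

Theorem theorem33 (n : nat) (F : fieldType) (xi : F) (a : ppart 'I_n)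
    (k : nat) (A : 'I_k -> {set 'I_n})
    (A_inj : injective A)
    (A_classes : [set A i | i : 'I_k] = kernel_classes a) :
  (a \in pidem_xi 'I_n xi
   <-> (a \in pidem 'I_n /\ prank a = k %[mod unity_order n xi]))
  /\
  ((a \in pidem 'I_n /\ prank a = k %[mod unity_order n xi])
   <-> [/\ a \in pdsum A,
           (forall i : 'I_k, (prank (prestr a (A i)) <= 1)%N)
         & (unity_order n xi %| #|[set i : 'I_k | prank (prestr a (A i)) == 0%N]|)%N]).
Proof.
have pidemP : a \in pidem 'I_n <->
    a \in pdsum A /\ (forall i, (prank (prestr a (A i)) <= 1)%N).
  rewrite inE.
  split=> [/eqP/idempotentP[loc single]|[/(pdsum_ker_local A_classes) loc rk]].
    split; first exact/(pdsum_ker_local A_classes).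
    exact/(rank_le1_single_transversal A_classes loc).
  apply/eqP/idempotentP; split=> //.
  exact/(rank_le1_single_transversal A_classes loc).
have rankE : a \in pidem 'I_n ->
    prank a = k %[mod unity_order n xi] <->
    (unity_order n xi %| #|[set i | prank (prestr a (A i)) == 0%N]|)%N.
  case/pidemP=> /(pdsum_ker_local A_classes) loc rk.
  have := prank_add_rank0 A_inj A_classes loc rk; rewrite card_ord => rE.
  rewrite -[in X in _ <-> is_true X](addKn (prank a) #|_|) rE -eqn_mod_dvd; last first.
    by rewrite -rE leq_addr.
  by rewrite eq_sym; split=> /eqP.
have floatE : a \in pidem 'I_n ->
    (xi ^+ pfloating a a == 1) =
    (unity_order n xi %| #|[set i | prank (prestr a (A i)) == 0%N]|)%N.
  case/pidemP=> /(pdsum_ker_local A_classes) loc _.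
  rewrite (pfloating_rank0 A_inj A_classes loc) unity_order_dvd //.
  apply: leq_trans (max_card _) _.
  by rewrite (leq_trans (leq_card_classes A_inj A_classes)) ?card_ord.
split; first rewrite pidem_xiE; split.
- by case/andP=> aI; rewrite floatE // => /(rankE aI).
- by case=> aI /(rankE aI); rewrite -floatE // aI.
- by case=> aI /(rankE aI) rk0; case/pidemP: aI.
- case=> aA rk rk0; have aI : a \in pidem 'I_n by apply/pidemP.
  by split=> //; apply/(rankE aI).
Qed.
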